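(* Let $A$ be a unital associative $k$-algebra, $H$ a conilpotent bialgebra over $k$, and $\varphi\in\mathcal{U}(H,A)$. Then the convolution inverse of $\varphi$ is given by $$\varphi^{\ast-1}=j^{\ast-1}\odot\varphi,$$ where $j^{\ast-1}$ is the convolution inverse in $\mathcal{U}(QSh(A),A)$ of the map $j$ defined by $j(1)=1_A$, $j(a_1)=a_1$, $j(a_1\cdots a_r)=0$ for $r\ge2$.
   Context: Everything is over a fixed field $k$ of characteristic $0$. Conilpotent: for a bialgebra $H$ with coproduct $\Delta$, counit $\eta$ and $H^+=\ker\eta$, the reduced coproduct on $H^+$ is $\Delta'(h)=\Delta(h)-1\otimes h-h\otimes 1$, with iterates $\Delta'^{[1]}=\mathrm{Id}$, $\Delta'^{[n+1]}=(\mathrm{Id}\otimes\Delta'^{[n]})\circ\Delta'$. $H$ is conilpotent if for each $h\in H^+$ there is $n\ge 1$ with $\Delta'^{[n]}(h)=0$. Convolution: for linear maps $f,g:H\to A$, $f\ast g=m_A\circ(f\otimes g)\circ\Delta$, with $m_A$ the product of $A$. $\mathcal{U}(H,A)$ is the set of linear maps $f:H\to A$ with $f(1_H)=1_A$; for $H$ conilpotent it is a group under $\ast$ with unit $u_A\circ\eta$ ($u_A:k\to A$ the unit map). $QSh(A)$, for an associative (not necessarily unital) algebra $A$ with product $\cdot_A$: $QSh(A)=\bigoplus_{n\ge0}A^{\otimes n}$, $A^{\otimes0}=k$, with $a_1\otimes\cdots\otimes a_n$ written as the word $a_1\cdots a_n$; unit $1\in A^{\otimes 0}$; product $\star$ given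 by $1\star v=v\star1=v$, $av\star bw=a(v\star bw)+b(av\star w)+(a\cdot_Ab)(v\star w)$; coproduct the deconcatenation $\Delta(a_1\cdots a_s)=\sum_{r=0}^s(a_1\cdots a_r)\otimes(a_{r+1}\cdots a_s)$; counit zero on words of length $\ge1$. It is a conilpotent bialgebra. $\iota:H\to QSh(H^+)$ is $\iota(1)=1$, $\iota(h)=\sum_{n\ge1}\Delta'^{[n]}(h)$ for $h\in H^+$, with $\Delta'^{[n]}(h)\in(H^+)^{\otimes n}$. For $\varphi\in\mathcal{U}(H,A)$, $QSh(\varphi):QSh(H^+)\to QSh(A)$ is the linear map $1\mapsto1$, $h_1\cdots h_r\mapsto\varphi(h_1)\cdots\varphi(h_r)$ (a word in $QSh(A)$). For $f\in\mathcal{U}(QSh(A),A)$, $f\odot\varphi:=f\circ QSh(\varphi)\circ\iota\in\mathcal{U}(H,A)$. *)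

(* Defs.v *)
From HB Require Import structures.
From mathcomp Require Import all_boot all_algebra.
From mathcomp Require Import generic_quotient ring_quotient finmap.
From mathcomp Require Import monalg.
From mathcomp Require Import boolp classical_sets cardinality fsbigop.

Set Implicit Arguments.
Unset Strict Implicit.
Unset Printing Implicit Defensive.

Import GRing.Theory.
Local Open Scope ring_scope.

Section LinearFacts.
Variables (k : fieldType).
Implicit Types U V W : lmodType k.

(* [linear], with the module structures kept as explicit arguments: this keeps
   unification on nested tensor products fast. *)
Definition islin U V (f : U -> V) : Prop := linear f.

Definition bilin U V W (f : U -> V -> W) : Prop :=
  (forall v, islin (f^~ v)) /\ (forall u, islin (f u)).

Lemma linP0 U V (f : U -> V) : islin f -> f 0 = 0.
Proof.
move=> lf; have := lf 1 0 0; rewrite !scale1r addr0 => /esym/eqP.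
by rewrite -subr_eq0 addrK => /eqP.
Qed.

Lemma linPD U V (f : U -> V) : islin f -> {morph f : x y / x + y}.
Proof. by move=> lf x y; rewrite -[x]scale1r lf !scale1r. Qed.

Lemma linPZ U V (f : U -> V) c : islin f -> {morph f : x / c *: x}.
Proof. by move=> lf x; rewrite -[c *: x]addr0 lf (linP0 lf) addr0. Qed.

Lemma linPN U V (f : U -> V) : islin f -> {morph f : x / - x}.
Proof. by move=> lf x; rewrite -!scaleN1r linPZ. Qed.

Lemma lin_comp U V W (g : V -> W) (f : U -> V) :
  islin g -> islin f -> islin (fun x => g (f x)).
Proof. by move=> lg lf c x y; rewrite lf lg. Qed.

Lemma lin_id U : islin (fun x : U => x). Proof. by []. Qed.

Lemma lin_add U V (f g : U -> V) :
  islin f -> islin g -> islin (fun x => f x + g x).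
Proof. by move=> lf lg c x y; rewrite lf lg scalerDr addrACA. Qed.

Lemma lin_opp U V (f : U -> V) : islin f -> islin (fun x => - f x).
Proof. by move=> lf c x y; rewrite lf opprD scalerN. Qed.

End LinearFacts.

(* The k-vector space presented by generators X and relations R. *)
Section Presented.
Variables (k : fieldType) (X : choiceType).
Local Notation F := {malg k[X]}.

Inductive lspan (R : F -> Prop) : F -> Prop :=
| lspan0 : lspan R 0
| lspanS c r x of R r & lspan R x : lspan R (c *: r + x).

Variable R : F -> Prop.

Definition lspan_pred : pred F := fun x => `[< lspan R x >].

Lemma lspanD x y : lspan R x -> lspan R y -> lspan R (x + y).
Proof.
by elim=> [|c r {}x Rr _ IH] Ry; rewrite ?add0r // -addrA; apply/lspanS/IH.
Qed.

Lemma lspanZ c x : lspan R x -> lspan R (c *: x).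
Proof.
elim=> [|d r {}x Rr _ IH]; first by rewrite scaler0; apply: lspan0.
by rewrite scalerDr scalerA; apply: lspanS.
Qed.

Lemma lspan_zmod : zmod_closed lspan_pred.
Proof.
split=> [|x y /asboolP Rx /asboolP Ry]; apply/asboolP; first exact: lspan0.
by apply: lspanD => //; rewrite -scaleN1r; apply: lspanZ.
Qed.

HB.instance Definition _ := GRing.isZmodClosed.Build F lspan_pred lspan_zmod.

Definition presented :=
  @Quotient.quot F (GRing.ZmodClosed.clone F lspan_pred _).
HB.instance Definition _ := GRing.Zmodule.on presented.
HB.instance Definition _ := EqQuotient.on presented.

Local Open Scope quotient_scope.

Definition ppi (x : F) : presented := \pi_presented x.

Lemma ppiB x y : ppi (x - y) = ppi x - ppi y.
Proof. exact: raddfB. Qed.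

Lemma ppi_eq x y : (ppi x = ppi y) <-> lspan R (x - y).
Proof.
split=> [/eqP e|e]; last apply/eqP.
  by apply/asboolP; rewrite -[asbool _]/(x - y \in lspan_pred) Quotient.idealrBE.
by rewrite /ppi -Quotient.idealrBE; apply/asboolP.
Qed.

Lemma ppi_repr q : ppi (repr q) = q. Proof. exact: reprK. Qed.

Definition pscale c (q : presented) := ppi (c *: repr q).

Lemma ppiZ c x : ppi (c *: x) = pscale c (ppi x).
Proof.
apply/ppi_eq; rewrite -scalerBr; apply: lspanZ; apply/ppi_eq.
by rewrite ppi_repr.
Qed.

Lemma pscaleA c d q : pscale c (pscale d q) = pscale (c * d) q.
Proof. by rewrite {2}/pscale -ppiZ scalerA. Qed.
Lemma pscale1 q : pscale 1 q = q.
Proof. by rewrite /pscale scale1r ppi_repr. Qed.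
Lemma ppiD x y : ppi (x + y) = ppi x + ppi y.
Proof. exact: raddfD. Qed.
Lemma pscaleDr c : {morph pscale c : x y / x + y}.
Proof.
move=> x y; rewrite -[x]ppi_repr -[y]ppi_repr -ppiD -!ppiZ -ppiD.
by rewrite scalerDr.
Qed.
Lemma pscaleDl q : {morph pscale^~ q : c d / c + d}.
Proof. by move=> c d; rewrite /pscale scalerDl ppiD. Qed.

HB.instance Definition _ := GRing.Zmodule_isLmodule.Build k presented
  pscaleA pscale1 pscaleDr pscaleDl.

Lemma ppi_linear : islin ppi.
Proof. by move=> c x y; rewrite ppiD ppiZ. Qed.

Definition fext (U : lmodType k) (f : X -> U) (x : F) : U :=
  \sum_(i <- msupp x) x@_i *: f i.

Lemma fextw (U : lmodType k) (f : X -> U) (d : {fset X}) x :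
  (msupp x `<=` d)%fset -> fext f x = \sum_(i <- d) x@_i *: f i.
Proof.
move=> le; rewrite /fext (big_fset_incl _ le) //= => i _ /mcoeff_outdom ->.
by rewrite scale0r.
Qed.

Lemma fext_linear (U : lmodType k) (f : X -> U) : islin (fext f).
Proof.
move=> c x y; pose d := (msupp x `|` msupp y)%fset.
rewrite (@fextw _ f d (_ + _)).
  rewrite (@fextw _ f d x) ?fsubsetUl // (@fextw _ f d y) ?fsubsetUr //.
  rewrite scaler_sumr -big_split /=; apply: eq_bigr => i _.
  by rewrite mcoeffD mcoeffZ scalerDl scalerA.
apply: fsubset_trans (msuppD_le _ _) _.
by apply: fsetUSS => //; apply: msuppZ_le.
Qed.

Lemma fextU (U : lmodType k) (f : X -> U) i : fext f << i >> = f i.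
Proof. by rewrite /fext msuppU oner_eq0 big_seq_fset1 mcoeffUU scale1r. Qed.

End Presented.

Arguments ppi {k X} R x.
Arguments fext {k X U} f x.

HB.lock Definition pgen (k : fieldType) (X : choiceType)
  (R : {malg k[X]} -> Prop) (x : X) : presented R := ppi R << x >>.

(* The map induced on the quotient; it depends on the choice of [repr] unless
   [f] respects the relations, which is the case in every use below. *)
HB.lock Definition plift (k : fieldType) (X : choiceType)
  (R : {malg k[X]} -> Prop) (U : lmodType k) (f : X -> U) (q : presented R) : U :=
  fext f (repr q).

Arguments pgen {k X} R x.
Arguments plift {k X R U} f q.

Section PresentedTheory.
Variables (k : fieldType) (X : choiceType) (R : {malg k[X]} -> Prop).
Local Notation presented := (presented R).
Local Notation ppi := (ppi R).

Section Lift.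
Variables (U : lmodType k) (f : X -> U).
Hypothesis fR : forall r, R r -> fext f r = 0.

Lemma plift_pi x : plift f (ppi x) = fext f x.
Proof.
apply/eqP; rewrite -subr_eq0 plift.unlock -linPN; last exact: fext_linear.
rewrite -linPD; last exact: fext_linear.
have : lspan R (repr (ppi x) - x) by apply/ppi_eq; rewrite ppi_repr.
elim=> [|c r y Rr _ /eqP IH]; first by rewrite linP0 //; apply: fext_linear.
by rewrite fext_linear fR // scaler0 add0r IH.
Qed.

Lemma plift_gen i : plift f (pgen R i) = f i.
Proof. by rewrite pgen.unlock plift_pi fextU. Qed.

Lemma plift_linear : islin (plift f : presented -> U).
Proof.
move=> c x y; rewrite -[x]ppi_repr -[y]ppi_repr -ppi_linear !plift_pi.
exact: fext_linear.
Qed.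
End Lift.

Lemma presentedP (U : lmodType k) (f g : presented -> U) :
  islin f -> islin g -> (forall i, f (pgen R i) = g (pgen R i)) -> f =1 g.
Proof.
move=> lf lg fg q; rewrite -[q]ppi_repr; set x := repr q.
have lin h : islin h -> h (ppi x) = \sum_(i <- msupp x) x@_i *: h (pgen R i) :> U.
  move=> lh; rewrite {1}[x]monalgE.
  have lhp := lin_comp lh (@ppi_linear _ _ R).
  rewrite (big_morph (fun x => h (ppi x)) (linPD lhp) (linP0 lhp)).
  apply: eq_bigr => i _; rewrite -(linPZ _ lh); congr h.
  rewrite pgen.unlock -(linPZ _ (@ppi_linear _ _ R)); congr ppi.
  by apply/malgP => j; rewrite mcoeffZ !mcoeffU mulrnAr mulr1.
by rewrite !lin //; apply: eq_bigr => i _; rewrite fg.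
Qed.

End PresentedTheory.

Section Tensor.
Variables (k : fieldType) (V W : lmodType k).

Inductive tens_rel : {malg k[(V * W)%type]} -> Prop :=
| TensRelL c v v' w : tens_rel
    (<< (c *: v + v', w) >> - (c *: << (v, w) >> + << (v', w) >>))
| TensRelR c v w w' : tens_rel
    (<< (v, c *: w + w') >> - (c *: << (v, w) >> + << (v, w') >>)).

Definition tensor := presented tens_rel.
HB.instance Definition _ := GRing.Lmodule.on tensor.

Definition tens (v : V) (w : W) : tensor := pgen tens_rel (v, w).

Definition tlift (U : lmodType k) (f : V -> W -> U) (t : tensor) : U :=
  plift (fun x => f x.1 x.2) t.

Lemma tens_bilin : bilin tens.
Proof.
split=> [w c v v'|v c w w'].
  rewrite /tens pgen.unlock -ppi_linear; apply/ppi_eq.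
  rewrite -[_ - _]addr0 -[_ - _]scale1r.
  by apply: lspanS; [exact: TensRelL | exact: lspan0].
rewrite /tens pgen.unlock -ppi_linear; apply/ppi_eq.
rewrite -[_ - _]addr0 -[_ - _]scale1r.
by apply: lspanS; [exact: TensRelR | exact: lspan0].
Qed.

Lemma tens_fR (U : lmodType k) (f : V -> W -> U) r :
  bilin f -> tens_rel r -> fext (fun x => f x.1 x.2) r = 0.
Proof.
move=> [fl fr] Rr; set h := fun x => _; have lh := fext_linear h.
by case: Rr => [c v v' w|c v w w'];
  rewrite (linPD lh) (linPN lh) lh !fextU /h /= ?fl ?fr subrr.
Qed.

Lemma tliftE (U : lmodType k) (f : V -> W -> U) v w :
  bilin f -> tlift f (tens v w) = f v w.
Proof. by move=> bf; rewrite /tlift plift_gen //= => r; apply: tens_fR. Qed.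

Lemma tlift_linear (U : lmodType k) (f : V -> W -> U) :
  bilin f -> islin (tlift f).
Proof. by move=> bf; apply: plift_linear => r; apply: tens_fR. Qed.

Lemma tensorP (U : lmodType k) (f g : tensor -> U) :
  islin f -> islin g -> (forall v w, f (tens v w) = g (tens v w)) -> f =1 g.
Proof. by move=> lf lg fg; apply: presentedP => // -[v w]; apply: fg. Qed.

Lemma tlift_param (X U : lmodType k) (f : X -> V -> W -> U) :
  (forall x, bilin (f x)) -> (forall v w, islin (fun x => f x v w)) ->
  forall t, islin (fun x => tlift (f x) t).
Proof.
move=> bf lf t c x y; move: t; apply: tensorP => [|d s t|v w].
- exact: tlift_linear.
- rewrite !(tlift_linear (bf _)) !scalerDr !scalerA addrACA.
  by rewrite ![_ * c]mulrC.
- by rewrite !tliftE // lf.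
Qed.

End Tensor.

Arguments tens {k V W} v w.
Arguments tlift {k V W U} f t.
Notation "v '\tens' w" := (tens v w) (at level 38, left associativity).

Section TensorMaps.
Variable k : fieldType.

Definition tmap (V W V' W' : lmodType k) (f : V -> V') (g : W -> W') :
  tensor V W -> tensor V' W' :=
  tlift (fun v w => f v \tens g w).

Definition tassoc (U V W : lmodType k) :
  tensor (tensor U V) W -> tensor U (tensor V W) :=
  tlift (fun t w => tlift (fun u v => u \tens (v \tens w)) t).

(* (a \tens b)(c \tens d) = ac \tens bd *)
Definition tmul (A B : algType k) (s t : tensor A B) : tensor A B :=
  tlift (fun a b => tlift (fun c d => (a * c) \tens (b * d)) t) s.

Lemma tmap_bilin (V W V' W' : lmodType k) (f : V -> V') (g : W -> W') :
  islin f -> islin g -> bilin (fun v w => f v \tens g w).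
Proof.
move=> lf lg; split=> [w|v] c x y.
  by rewrite lf (tens_bilin _ _).1.
by rewrite lg (tens_bilin _ _).2.
Qed.

Lemma tmap_linear (V W V' W' : lmodType k) (f : V -> V') (g : W -> W') :
  islin f -> islin g -> islin (tmap f g).
Proof. by move=> lf lg; apply/tlift_linear/tmap_bilin. Qed.

Lemma tmapE (V W V' W' : lmodType k) (f : V -> V') (g : W -> W') v w :
  islin f -> islin g -> tmap f g (v \tens w) = f v \tens g w.
Proof. by move=> lf lg; rewrite /tmap tliftE //; apply: tmap_bilin. Qed.

Lemma tassoc_bilin0 (U V W : lmodType k) (w : W) :
  bilin (fun (u : U) (v : V) => u \tens (v \tens w)).
Proof.
split=> [v|u] c x y; first by rewrite (tens_bilin _ _).1.
by rewrite (tens_bilin _ _).1 (tens_bilin _ _).2.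
Qed.

Lemma tassoc_bilin (U V W : lmodType k) :
  bilin (fun (t : tensor U V) (w : W) => tlift (fun u v => u \tens (v \tens w)) t).
Proof.
split=> [w|t]; first exact/tlift_linear/tassoc_bilin0.
apply: (@tlift_param _ _ _ _ _ (fun w u v => u \tens (v \tens w))) => [w|u v].
  exact: tassoc_bilin0.
by move=> c x y; rewrite !(tens_bilin _ _).2.
Qed.

Lemma tassoc_linear (U V W : lmodType k) : islin (@tassoc U V W).
Proof. exact/tlift_linear/tassoc_bilin. Qed.

Lemma tassocE (U V W : lmodType k) (u : U) (v : V) (w : W) :
  tassoc (u \tens v \tens w) = u \tens (v \tens w).
Proof.
rewrite /tassoc tliftE; last exact: tassoc_bilin.
by rewrite tliftE //; apply: tassoc_bilin0.
Qed.

Lemma lin_mulr (A : algType k) (a : A) : islin (fun x => a * x).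
Proof. by move=> c x y; rewrite mulrDr scalerAr. Qed.
Lemma lin_mull (A : algType k) (a : A) : islin (fun x => x * a).
Proof. by move=> c x y; rewrite mulrDl scalerAl. Qed.

Lemma tmul_bilin0 (A B : algType k) (a : A) (b : B) :
  bilin (fun c d => (a * c) \tens (b * d)).
Proof. by apply: tmap_bilin; apply: lin_mulr. Qed.

Lemma tmul_bilin1 (A B : algType k) (t : tensor A B) :
  bilin (fun a b => tlift (fun c d => (a * c) \tens (b * d)) t).
Proof.
split=> [b|a].
- apply: (@tlift_param _ _ _ _ _ (fun a c d => (a * c) \tens (b * d))).
    by move=> a; apply: tmul_bilin0.
  by move=> c d; apply: (lin_comp (g := tens^~ _));
     [apply: (tens_bilin _ _).1|apply: lin_mull].
- apply: (@tlift_param _ _ _ _ _ (fun b c d => (a * c) \tens (b * d))).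
    by move=> b; apply: tmul_bilin0.
  by move=> c d; apply: (lin_comp (g := tens _));
     [apply: (tens_bilin _ _).2|apply: lin_mull].
Qed.

Lemma tmul_bilin (A B : algType k) : bilin (@tmul A B).
Proof.
split=> [t|s]; first exact/tlift_linear/tmul_bilin1.
apply: (@tlift_param _ _ _ _ _
  (fun t a b => tlift (fun c d => (a * c) \tens (b * d)) t)) => [t|a b].
  exact: tmul_bilin1.
exact/tlift_linear/tmul_bilin0.
Qed.

Lemma tmulE (A B : algType k) (a c : A) (b d : B) :
  tmul (a \tens b) (c \tens d) = (a * c) \tens (b * d).
Proof.
rewrite /tmul (tliftE _ _ (tmul_bilin1 _)) tliftE //.
exact: tmul_bilin0.
Qed.

End TensorMaps.

Arguments tmap {k V W V' W'} f g t.
Arguments tassoc {k U V W} t.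
Arguments tmul {k A B} s t.

HB.mixin Record isBialgebra (k : fieldType) H of GRing.Algebra k H := {
  cop : H -> tensor H H;
  counit : H -> k;
  cop_linear : islin cop;
  counit_linear : scalar counit;
  cop_coassoc : forall h, tassoc (tmap cop id (cop h)) = tmap id cop (cop h);
  cop_counitl : forall h, tlift (fun x y => counit x *: y) (cop h) = h;
  cop_counitr : forall h, tlift (fun x y => counit y *: x) (cop h) = h;
  cop1 : cop 1 = 1 \tens 1;
  copM : forall g h, cop (g * h) = tmul (cop g) (cop h);
  counit1 : counit 1 = 1;
  counitM : {morph counit : g h / g * h}
}.

#[short(type="bialgType")]
HB.structure Definition Bialgebra (k : fieldType) :=
  {H of GRing.Algebra k H & isBialgebra k H}.

(* The direct sum of all tensor powers of V, presented by the words on V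
   subject to multilinearity in each letter; [word [:: a1; ..; an]] is
   a1 \tens .. \tens an in the n-th power, and [word [::]] is the 1 of the
   0-th power. *)
Section Words.
Variables (k : fieldType) (V : lmodType k).

Variant word_rel : {malg k[seq V]} -> Prop :=
| WordRel u v c a b : word_rel
    (<< u ++ (c *: a + b) :: v >>
     - (c *: << u ++ a :: v >> + << u ++ b :: v >>)).

Definition words := presented word_rel.
HB.instance Definition _ := GRing.Lmodule.on words.

Definition word (w : seq V) : words := pgen word_rel w.

Definition wlift (U : lmodType k) (f : seq V -> U) (t : words) : U := plift f t.

Definition multilin (U : lmodType k) (f : seq V -> U) : Prop :=
  forall u v c a b,
    f (u ++ (c *: a + b) :: v) = c *: f (u ++ a :: v) + f (u ++ b :: v).

Lemma word_multilin : multilin word.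
Proof.
move=> u v c a b.
rewrite /word pgen.unlock -ppi_linear; apply/ppi_eq.
rewrite -[_ - _]addr0 -[_ - _]scale1r.
by apply: lspanS; [exact: WordRel | exact: lspan0].
Qed.

Lemma word_fR (U : lmodType k) (f : seq V -> U) r :
  multilin f -> word_rel r -> fext f r = 0.
Proof.
move=> mf [u v c a b]; have lh := fext_linear f.
by rewrite (linPD lh) (linPN lh) lh !fextU mf subrr.
Qed.

Lemma wliftE (U : lmodType k) (f : seq V -> U) w :
  multilin f -> wlift f (word w) = f w.
Proof. by move=> mf; rewrite /wlift plift_gen //= => r; apply: word_fR. Qed.

Lemma wlift_linear (U : lmodType k) (f : seq V -> U) :
  multilin f -> islin (wlift f).
Proof. by move=> mf; apply: plift_linear => r; apply: word_fR. Qed.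

Lemma wordsP (U : lmodType k) (f g : words -> U) :
  islin f -> islin g -> (forall w, f (word w) = g (word w)) -> f =1 g.
Proof. exact: presentedP. Qed.

Lemma wlift_param (X U : lmodType k) (f : X -> seq V -> U) :
  (forall x, multilin (f x)) -> (forall w, islin (fun x => f x w)) ->
  forall t, islin (fun x => wlift (f x) t).
Proof.
move=> mf lf t c x y; move: t; apply: wordsP => [|d s t|w].
- exact: wlift_linear.
- rewrite !(wlift_linear (mf _)) !scalerDr !scalerA addrACA.
  by rewrite ![_ * c]mulrC.
- by rewrite !wliftE // lf.
Qed.

Definition wcons (a : V) : words -> words := wlift (fun w => word (a :: w)).

Lemma wcons_multilin a : multilin (fun w => word (a :: w)).
Proof. by move=> u v c b d; rewrite -!cat_cons word_multilin. Qed.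

Lemma wconsE a w : wcons a (word w) = word (a :: w).
Proof. by rewrite /wcons wliftE //; apply: wcons_multilin. Qed.

Lemma wcons_bilin : bilin wcons.
Proof.
split=> [t|a]; last exact/wlift_linear/wcons_multilin.
apply: wlift_param => [a|w]; first exact: wcons_multilin.
by move=> c a b; rewrite (word_multilin [::]).
Qed.

Lemma words_eq (U : lmodType k) (f g : words -> U) :
  islin f -> islin g -> f (word [::]) = g (word [::]) ->
  (forall a w, f (word w) = g (word w) ->
     f (wcons a (word w)) = g (wcons a (word w))) -> f =1 g.
Proof.
move=> lf lg fg0 fgS; apply: wordsP => //.
by elim=> [|a w IH] //; rewrite -wconsE fgS.
Qed.

Definition deconc_word (w : seq V) : tensor words words :=
  \sum_(r < (size w).+1) word (take r w) \tens word (drop r w).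

Definition deconc : words -> tensor words words := wlift deconc_word.

Definition wcounit : words -> k := wlift (fun w => (nilp w)%:R : k^o).

Lemma lin_tensr (U W : lmodType k) (u : U) : islin (fun w : W => u \tens w).
Proof. exact: (tens_bilin _ _).2. Qed.

Lemma lin_tensl (U W : lmodType k) (w : W) : islin (fun u : U => u \tens w).
Proof. exact: (tens_bilin _ _).1. Qed.

Lemma lin_wcons a : islin (wcons a). Proof. exact: wcons_bilin.2. Qed.

Lemma deconc_cons a w : deconc_word (a :: w) =
  word [::] \tens word (a :: w) + tmap (wcons a) id (deconc_word w).
Proof.
rewrite /deconc_word big_ord_recl /=; congr (_ + _).
have lt := tmap_linear (lin_wcons a) (@lin_id k words).
rewrite (big_morph _ (linPD lt) (linP0 lt)); apply: eq_bigr => i _.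
by rewrite tmapE // ?wconsE //; apply: lin_wcons.
Qed.

Lemma deconc_multilin : multilin deconc_word.
Proof.
elim=> [|x u IH] v c a b.
  rewrite /= !deconc_cons scalerDr addrACA; congr (_ + _).
    by rewrite (word_multilin [::]) lin_tensr.
  apply: (tlift_param (f := fun a v w => wcons a v \tens w)) => [y|s t].
    by apply: tmap_bilin => //; apply: lin_wcons.
  exact: (lin_comp (@lin_tensl _ _ t) (wcons_bilin.1 s)).
rewrite !cat_cons !deconc_cons scalerDr addrACA; congr (_ + _).
  by rewrite -!cat_cons word_multilin lin_tensr.
by rewrite IH; apply: tmap_linear => //; apply: lin_wcons.
Qed.

Lemma deconc_linear : islin deconc.
Proof. exact/wlift_linear/deconc_multilin. Qed.

Lemma deconc1 : deconc (word [::]) = word [::] \tens word [::].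
Proof.
rewrite /deconc wliftE; last exact: deconc_multilin.
by rewrite /deconc_word big_ord1.
Qed.

Lemma deconcS a x :
  deconc (wcons a x) = word [::] \tens wcons a x + tmap (wcons a) id (deconc x).
Proof.
move: x; apply: wordsP => [||w].
- exact: lin_comp deconc_linear (lin_wcons a).
- apply: lin_add; first exact: lin_comp (@lin_tensr _ _ _) (lin_wcons a).
  exact: lin_comp (tmap_linear (lin_wcons a) (@lin_id _ _)) deconc_linear.
rewrite wconsE /deconc !wliftE ?deconc_cons //; exact: deconc_multilin.
Qed.

Lemma wcounit_multilin : multilin (fun w : seq V => (nilp w)%:R : k^o).
Proof. by case=> [|x u] v c a b /=; rewrite scaler0 addr0. Qed.

Lemma wcounit_linear : scalar wcounit.
Proof. exact: (wlift_linear wcounit_multilin). Qed.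

Lemma wcounit1 : wcounit (word [::]) = 1.
Proof. by rewrite /wcounit wliftE //; apply: wcounit_multilin. Qed.

Lemma wcounitS a x : wcounit (wcons a x) = 0.
Proof.
move: x; apply: (@wordsP k^o) => [||w].
- exact: (@lin_comp k words words k^o wcounit (wcons a) wcounit_linear (lin_wcons a)).
- by move=> c x y; rewrite scaler0 addr0.
by rewrite wconsE /wcounit wliftE //; apply: wcounit_multilin.
Qed.

End Words.

Arguments word {k V} w.
Arguments wlift {k V U} f t.
Arguments wcons {k V} a t.
Arguments deconc {k V} t.
Arguments wcounit {k V} t.

Section DeconcCoalgebra.
Variables (k : fieldType) (V : lmodType k).
Local Notation W := (words V).
Local Notation "1w" := (word ([::] : seq V)).
Local Notation tcons a := (tmap (wcons a) (id : W -> W)).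

Let lid := @lin_id k W.
Let ltc (a : V) : islin (tcons a) := tmap_linear (lin_wcons a) lid.
Let lD := @deconc_linear k V.
Let lDi : islin (tmap deconc id) := tmap_linear lD lid.
Let liD : islin (tmap id deconc) := tmap_linear lid lD.

Lemma deconc_coassoc (x : W) :
  tassoc (tmap deconc id (deconc x)) = tmap id deconc (deconc x).
Proof.
have lta : islin (@tassoc k W W W) := @tassoc_linear _ _ _ _.
have lf : islin (fun x : W => tassoc (tmap deconc id (deconc x))).
  exact: lin_comp lta (lin_comp lDi lD).
have lg : islin (fun x : W => tmap id deconc (deconc x)).
  exact: lin_comp liD lD.
move: x; apply: words_eq => //.
  by rewrite deconc1 !tmapE // ?deconc1 ?tassocE.
move=> a w; set x := word w => IH.
have lA : islin (tmap (wcons a) (id : tensor W W -> tensor W W)).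
  exact: tmap_linear (lin_wcons a) (@lin_id _ _).
rewrite deconcS (linPD lDi) (linPD liD) (linPD lta) tmapE // deconc1 tassocE.
rewrite tmapE // deconcS (linPD (@lin_tensr _ _ _ _)).
suff -> : tassoc (tmap deconc id (tcons a (deconc x))) =
    1w \tens tcons a (deconc x) + tmap (wcons a) id (tassoc (tmap deconc id (deconc x))).
  suff -> : tmap id deconc (tcons a (deconc x)) =
    tmap (wcons a) id (tmap id deconc (deconc x)) by rewrite IH addrA.
  move: (deconc x); apply: tensorP => [||p q].
  - exact: lin_comp liD (ltc a).
  - exact: lin_comp lA liD.
  - by rewrite !tmapE //; apply: lin_wcons.
move: (deconc x); apply: tensorP => [||p q].
- exact: lin_comp lta (lin_comp lDi (ltc a)).
- apply: lin_add; first exact: lin_comp (@lin_tensr _ _ _ _) (ltc a).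
  exact: lin_comp lA (lin_comp lta lDi).
rewrite !tmapE //; try exact: lin_wcons.
rewrite deconcS (linPD (@lin_tensl _ _ _ q)) (linPD lta) tassocE; congr (_ + _).
move: (deconc p); apply: tensorP => [||s t].
- exact: lin_comp lta (lin_comp (@lin_tensl _ _ _ q) (ltc a)).
- exact: lin_comp lA (lin_comp lta (@lin_tensl _ _ _ q)).
by rewrite tassocE !tmapE ?tassocE //; apply: lin_wcons.
Qed.

Lemma counitl_bilin : bilin (fun x y : W => wcounit x *: y).
Proof.
split=> [y|x] c u v; last by rewrite scalerDr !scalerA mulrC.
by rewrite (@wcounit_linear k V) scalerDl scalerA.
Qed.

Lemma counitr_bilin : bilin (fun x y : W => wcounit y *: x).
Proof. by split=> [y|x]; [apply: counitl_bilin.2|apply: counitl_bilin.1]. Qed.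

Lemma deconc_counitl (x : W) :
  tlift (fun x y => wcounit x *: y) (deconc x) = x.
Proof.
have lt := tlift_linear counitl_bilin.
move: x; apply: words_eq => //; first exact: lin_comp lt lD.
  by rewrite deconc1 tliftE ?wcounit1 ?scale1r //; apply: counitl_bilin.
move=> a w _; rewrite deconcS (linPD lt) tliftE; last exact: counitl_bilin.
rewrite wcounit1 scale1r -[RHS]addr0; congr (_ + _).
move: (deconc _); apply: tensorP => [||p q].
- exact: lin_comp lt (ltc a).
- by move=> c s t; rewrite scaler0 addr0.
rewrite tmapE //; last exact: lin_wcons.
by rewrite tliftE ?wcounitS ?scale0r //; apply: counitl_bilin.
Qed.

Lemma deconc_counitr (x : W) :
  tlift (fun x y => wcounit y *: x) (deconc x) = x.
Proof.
have lt := tlift_linear counitr_bilin.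
move: x; apply: words_eq => //; first exact: lin_comp lt lD.
  by rewrite deconc1 tliftE ?wcounit1 ?scale1r //; apply: counitr_bilin.
move=> a w IH; rewrite deconcS (linPD lt) tliftE; last exact: counitr_bilin.
rewrite wcounitS scale0r add0r -[in RHS]IH.
move: (deconc _); apply: tensorP => [||p q].
- exact: lin_comp lt (ltc a).
- exact: lin_comp (lin_wcons a) lt.
rewrite tmapE //; last exact: lin_wcons.
rewrite !tliftE; try exact: counitr_bilin.
by rewrite (linPZ _ (lin_wcons a)).
Qed.

End DeconcCoalgebra.

Lemma addr3ACA (M : zmodType) (a1 b1 a2 b2 a3 b3 : M) :
  (a1 + b1) + (a2 + b2) + (a3 + b3) = (a1 + a2 + a3) + (b1 + b2 + b3).
Proof. by rewrite (addrACA a1) (addrACA (a1 + a2)). Qed.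

Section TmulOps.
Variables (k : fieldType) (Q : algType k).
Local Notation T := (tensor Q Q).

Let tml (t : T) : islin (tmul^~ t) := (@tmul_bilin k Q Q).1 t.
Let tmr (t : T) : islin (tmul t) := (@tmul_bilin k Q Q).2 t.

Lemma tmul_11l (t : T) : tmul (1 \tens 1) t = t.
Proof.
move: t; apply: tensorP => [||p q].
- exact: tmr.
- exact: lin_id.
by rewrite tmulE !mul1r.
Qed.

Lemma tmul_11r (t : T) : tmul t (1 \tens 1) = t.
Proof.
move: t; apply: tensorP => [||p q].
- exact: tml.
- exact: lin_id.
by rewrite tmulE !mulr1.
Qed.

Variables f g h : Q -> Q.
Hypotheses (lf : islin f) (lg : islin g) (lh : islin h).
Hypothesis fg : forall x y, f x * g y = f (x * g y) + g (f x * y) + h (x * y).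
Local Notation tc f := (tmap f (id : Q -> Q)).
Let ltf : islin (tc f) := tmap_linear lf (@lin_id k Q).
Let ltg : islin (tc g) := tmap_linear lg (@lin_id k Q).
Let lth : islin (tc h) := tmap_linear lh (@lin_id k Q).

Lemma tmul_1tc (f' : Q -> Q) (y : Q) t : islin f' ->
  tmul (1 \tens y) (tc f' t) = tc f' (tmul (1 \tens y) t).
Proof.
move=> lf'; have ltf' := tmap_linear lf' (@lin_id k Q).
move: t; apply: tensorP => [||p q].
- exact: lin_comp (tmr _) ltf'.
- exact: lin_comp ltf' (tmr _).
by rewrite tmapE // !tmulE tmapE // !mul1r.
Qed.

Lemma tmul_tc1 (f' : Q -> Q) (y : Q) t : islin f' ->
  tmul (tc f' t) (1 \tens y) = tc f' (tmul t (1 \tens y)).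
Proof.
move=> lf'; have ltf' := tmap_linear lf' (@lin_id k Q).
move: t; apply: tensorP => [||p q].
- exact: lin_comp (tml _) ltf'.
- exact: lin_comp ltf' (tml _).
by rewrite tmapE // !tmulE tmapE // !mulr1.
Qed.

Lemma tmul_tctc s t : tmul (tc f s) (tc g t) =
  tc f (tmul s (tc g t)) + tc g (tmul (tc f s) t) + tc h (tmul s t).
Proof.
move: s; apply: tensorP => [||p q].
- exact: lin_comp (tml _) ltf.
- apply: lin_add; last exact: lin_comp lth (tml _).
  apply: lin_add; first exact: lin_comp ltf (tml _).
  exact: lin_comp ltg (lin_comp (tml _) ltf).
move: t; apply: tensorP => [||r s].
- exact: lin_comp (tmr _) ltg.
- apply: lin_add; last exact: lin_comp lth (tmr _).
  apply: lin_add; first exact: lin_comp ltf (lin_comp (tmr _) ltg).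
  exact: lin_comp ltg (tmr _).
rewrite !(tmapE _ _ lf) // !(tmapE _ _ lg) // !tmulE.
rewrite !(tmapE _ _ lf) // !(tmapE _ _ lg) // !(tmapE _ _ lh) // fg.
by rewrite !(linPD (@lin_tensl k Q Q _)).
Qed.

(* The inductive step of the multiplicativity of deconcatenation. *)
Lemma copM_step (D : Q -> T) (x y : Q) : islin D ->
  (forall x, D (f x) = 1 \tens f x + tc f (D x)) ->
  (forall x, D (g x) = 1 \tens g x + tc g (D x)) ->
  (forall x, D (h x) = 1 \tens h x + tc h (D x)) ->
  D (x * g y) = tmul (D x) (D (g y)) ->
  D (f x * y) = tmul (D (f x)) (D y) ->
  D (x * y) = tmul (D x) (D y) ->
  D (f x * g y) = tmul (D (f x)) (D (g y)).
Proof.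
move=> lD Df Dg Dh IH1 IH2 IH3.
rewrite fg !(linPD lD) Df Dg Dh IH1 IH2 IH3 Df Dg.
move: (D x) (D y) => X Y.
rewrite !(linPD (tml _)) !(linPD (tmr _)) tmul_tctc tmulE mul1r fg.
rewrite tmul_tc1 // tmul_1tc // !(linPD ltf) !(linPD ltg).
rewrite !(linPD (@lin_tensr k Q Q _)).
by rewrite [LHS](AC (((1*2)*(1*2))*2) ((1*4*7)*5*(2*(3*6*8)))).
Qed.

End TmulOps.

(* The quasi-shuffle bialgebra of A: the words on A with the product
   a v * b w = a (v * b w) + b (a v * w) + (ab) (v * w) and deconcatenation. *)
Section QuasiShuffle.
Variables (k : fieldType) (A : algType k).

Definition QSh := words A.
HB.instance Definition _ := GRing.Lmodule.on QSh.

Fixpoint qsh_word (u : seq A) : seq A -> QSh :=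
  fix qsh_word_u (v : seq A) : QSh :=
    match u, v with
    | [::], _ => word v
    | _, [::] => word u
    | a :: u', b :: v' =>
        wcons a (qsh_word u' v) + wcons b (qsh_word_u v')
        + wcons (a * b) (qsh_word u' v')
    end.

Definition qsh (x y : QSh) : QSh :=
  wlift (fun u => wlift (qsh_word u) y) x.

Definition qsh_counit (x : QSh) : k := wcounit x.

Lemma qsh_wordSS a u b v : qsh_word (a :: u) (b :: v) =
  wcons a (qsh_word u (b :: v)) + wcons b (qsh_word (a :: u) v)
  + wcons (a * b) (qsh_word u v).
Proof. by []. Qed.

Lemma qsh_word0 v : qsh_word [::] v = word v. Proof. by case: v. Qed.
Lemma qsh_wordn0 u : qsh_word u [::] = word u. Proof. by case: u. Qed.

Let lcons (a : A) : islin (wcons a) := lin_wcons a.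
Let lconsl (x : words A) : islin (fun a : A => wcons a x) := (@wcons_bilin k A).1 x.

Lemma qsh_word_multilinl v : multilin (qsh_word^~ v).
Proof.
suff H u w c a b : qsh_word (u ++ (c *: a + b) :: w) v =
    c *: qsh_word (u ++ a :: w) v + qsh_word (u ++ b :: w) v by move=> u w c a b.
elim: u v => [|x u IHu] v; elim: v => [|y v IHv].
- by rewrite !qsh_wordn0 (word_multilin [::]).
- rewrite !cat0s in IHv *.
  rewrite !qsh_wordSS IHv mulrDl -scalerAl !lconsl (lcons y) !scalerDr.
  exact: addr3ACA.
- by rewrite !qsh_wordn0 word_multilin.
- rewrite !cat_cons in IHv *.
  rewrite !qsh_wordSS IHv !IHu !lcons !scalerDr.
  exact: addr3ACA.
Qed.

Lemma qsh_word_multilinr u : multilin (qsh_word u).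
Proof.
elim: u => [|x u IHu] v; first by move=> w c a b; rewrite !qsh_word0 word_multilin.
elim: v => [|y v IHv] w c a b.
  rewrite !cat0s !qsh_wordSS (IHu [::]) mulrDr -scalerAr !lconsl (lcons x) !scalerDr.
  exact: addr3ACA.
rewrite !cat_cons !qsh_wordSS IHv -!cat_cons !IHu !lcons !scalerDr.
exact: addr3ACA.
Qed.

Lemma qsh_multilin (y : QSh) : multilin (fun u => wlift (qsh_word u) y).
Proof.
move=> u v c a b; move: y; apply: wordsP => [||w].
- exact: wlift_linear (@qsh_word_multilinr _).
- move=> d s t; rewrite !(wlift_linear (@qsh_word_multilinr _)).
  by rewrite !scalerDr !scalerA addrACA ![_ * c]mulrC.
rewrite !wliftE ?qsh_word_multilinl //; exact: qsh_word_multilinr.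
Qed.

Lemma qsh_bilin : bilin qsh.
Proof.
split=> [y|x]; first exact/wlift_linear/qsh_multilin.
apply: (wlift_param (f := fun y u => wlift (qsh_word u) y)) => [y|u].
  exact: qsh_multilin.
exact/wlift_linear/qsh_word_multilinr.
Qed.

Let ql (y : QSh) : islin (qsh^~ y) := qsh_bilin.1 y.
Let qr (x : QSh) : islin (qsh x) := qsh_bilin.2 x.

Lemma qsh_wordE u v : qsh (word u) (word v) = qsh_word u v.
Proof.
rewrite /qsh wliftE; last exact: qsh_multilin.
by rewrite wliftE //; apply: qsh_word_multilinr.
Qed.

Lemma qsh1l (x : QSh) : qsh (word [::]) x = x.
Proof.
by move: x; apply: wordsP => // w; rewrite qsh_wordE qsh_word0.
Qed.

Lemma qsh1r (x : QSh) : qsh x (word [::]) = x.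
Proof.
move: x; apply: wordsP => // w; by rewrite qsh_wordE qsh_wordn0.
Qed.

Lemma qshSS a b (x y : QSh) : qsh (wcons a x) (wcons b y) =
  wcons a (qsh x (wcons b y)) + wcons b (qsh (wcons a x) y)
  + wcons (a * b) (qsh x y).
Proof.
move: y; apply: wordsP => [||v].
- exact: lin_comp (qr _) (lcons b).
- apply: lin_add; last exact: lin_comp (lcons _) (qr x).
  apply: lin_add; first exact: lin_comp (lcons a) (lin_comp (qr x) (lcons b)).
  exact: lin_comp (lcons b) (qr _).
move: x; apply: wordsP => [||u].
- exact: lin_comp (ql _) (lcons a).
- apply: lin_add; last exact: lin_comp (lcons _) (ql _).
  apply: lin_add; first exact: lin_comp (lcons a) (ql _).
  exact: lin_comp (lcons b) (lin_comp (ql _) (lcons a)).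
by rewrite !wconsE !qsh_wordE qsh_wordSS.
Qed.

Lemma qsh_word_ind2 (P : seq A -> seq A -> Prop) :
  (forall v, P [::] v) -> (forall u, P u [::]) ->
  (forall a u b v, P u (b :: v) -> P (a :: u) v -> P u v -> P (a :: u) (b :: v)) ->
  forall u v, P u v.
Proof.
move=> P0 Pn PS; elim=> [|a u IHu] // v; elim: v => [|b v IHv] //.
by apply: PS.
Qed.

Lemma qshA : associative qsh.
Proof.
move=> x y z; move: x; apply: wordsP => [||u].
- exact: ql.
- exact: lin_comp (ql z) (ql y).
move: y; apply: wordsP => [||v].
- exact: lin_comp (qr _) (ql z).
- exact: lin_comp (ql z) (qr _).
move: z; apply: wordsP => [||w].
- exact: lin_comp (qr _) (qr _).
- exact: qr.
elim: u v w => [|a u IHu] v w; first by rewrite !qsh1l.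
elim: v w => [|b v IHv] w; first by rewrite qsh1l qsh1r.
elim: w => [|c w IHw]; first by rewrite !qsh1r.
have IHu1 := IHu (b :: v) (c :: w); have IHu2 := IHu (b :: v) w.
have IHu3 := IHu v (c :: w); have IHu4 := IHu v w.
have IHv1 := IHv (c :: w); have IHv2 := IHv w.
move: IHu1 IHu2 IHu3 IHu4 IHv1 IHv2 IHw; clear IHu IHv.
rewrite -!wconsE; move: (word u) (word v) (word w) => {u v w} u v w.
rewrite !qshSS => IHu1 IHu2 IHu3 IHu4 IHv1 IHv2 IHw.
rewrite !(linPD (qr _)) !(linPD (ql _)) !qshSS.
have e1 : qsh u (wcons b (qsh v (wcons c w))) + qsh u (wcons c (qsh (wcons b v) w))
  + qsh u (wcons (b * c) (qsh v w)) = qsh (qsh u (wcons b v)) (wcons c w).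
  by rewrite -!(linPD (qr _)).
have e2 : qsh (wcons a (qsh u (wcons b v))) w + qsh (wcons b (qsh (wcons a u) v)) w
  + qsh (wcons (a * b) (qsh u v)) w = qsh (wcons a u) (qsh (wcons b v) w).
  by rewrite -!(linPD (ql _)) -IHw.
rewrite IHv1 IHv2 IHu2 IHu3 IHu4 -e1 !(linPD (lcons _)).
have -> : wcons c (qsh (wcons a u) (qsh (wcons b v) w)) =
  wcons c (qsh (wcons a (qsh u (wcons b v))) w)
  + wcons c (qsh (wcons b (qsh (wcons a u) v)) w)
  + wcons c (qsh (wcons (a * b) (qsh u v)) w).
  by rewrite -e2 !(linPD (lcons _)).
rewrite mulrA.
by rewrite [LHS](AC ((3*(1*3*1))*3) ((1*4*9*5*8)*(2*6*10)*(3*7*11))).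
Qed.

Lemma qsh_neq0 : word [::] != 0 :> QSh.
Proof.
apply: contraTneq (oner_neq0 k) => e.
by rewrite -(wcounit1 A) e (linP0 (V := k^o) (@wcounit_linear k A)) eqxx.
Qed.

Lemma qshDl : left_distributive qsh +%R.
Proof. by move=> x y z; apply: (linPD (ql z)). Qed.

Lemma qshDr : right_distributive qsh +%R.
Proof. by move=> x y z; apply: (linPD (qr x)). Qed.

HB.instance Definition _ := GRing.Zmodule_isNzRing.Build QSh
  qshA qsh1l qsh1r qshDl qshDr qsh_neq0.

Lemma qshZl (c : k) (x y : QSh) : c *: (x * y) = (c *: x) * y.
Proof. by apply/esym; apply: (linPZ c (ql y)). Qed.

HB.instance Definition _ := GRing.Lmodule_isLalgebra.Build k QSh qshZl.

Lemma qshZr (c : k) (x y : QSh) : c *: (x * y) = x * (c *: y).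
Proof. by apply/esym; apply: (linPZ c (qr x)). Qed.

HB.instance Definition _ := GRing.Lalgebra_isAlgebra.Build k QSh qshZr.

Definition qsh_cop (x : QSh) : tensor QSh QSh := deconc x.

Lemma qsh_cop_linear : islin qsh_cop. Proof. exact: deconc_linear. Qed.

Lemma qsh_cop1 : qsh_cop 1 = 1 \tens 1. Proof. exact: deconc1. Qed.

Lemma qsh_copM x y : qsh_cop (x * y) = tmul (qsh_cop x) (qsh_cop y).
Proof.
have ml z : islin (fun x : QSh => x * z) := @lin_mull k QSh z.
have mr z : islin (fun x : QSh => z * x) := @lin_mulr k QSh z.
have lD := qsh_cop_linear.
have tml t : islin (tmul^~ t) := (@tmul_bilin k QSh QSh).1 t.
have tmr t : islin (tmul t) := (@tmul_bilin k QSh QSh).2 t.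
move: x; apply: wordsP => [||u].
- exact: lin_comp lD (ml y).
- exact: lin_comp (tml _) lD.
move: y; apply: wordsP => [||v].
- exact: lin_comp lD (mr _).
- exact: lin_comp (tmr _) lD.
move: u v; apply: qsh_word_ind2 => [v|u|a u b v].
- by rewrite mul1r qsh_cop1 tmul_11l.
- by rewrite mulr1 qsh_cop1 tmul_11r.
rewrite -!wconsE; move: (word u) (word v) => {u v} x y IH1 IH2 IH3.
apply: (@copM_step k QSh (wcons a) (wcons b) (wcons (a * b))) => //;
  by [exact: lin_wcons | exact: qshSS | exact: deconcS].
Qed.

Lemma qsh_counit1 : qsh_counit 1 = 1. Proof. exact: wcounit1. Qed.

Lemma qsh_counitM : {morph qsh_counit : x y / x * y}.
Proof.
have lc : islin (qsh_counit : QSh -> k^o) := @wcounit_linear k A.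
have ml z : islin (fun x : QSh => x * z) := @lin_mull k QSh z.
have mr z : islin (fun x : QSh => z * x) := @lin_mulr k QSh z.
have cl z : islin (fun x : k^o => x * z : k^o) := @lin_mull k k^o z.
have cr z : islin (fun x : k^o => z * x : k^o) := @lin_mulr k k^o z.
have c0 a x : qsh_counit (wcons a x) = 0 := wcounitS a x.
move=> x y; move: x; apply: (@wordsP k A k^o) => [||u].
- exact: lin_comp lc (ml y).
- exact: lin_comp (cl _) lc.
move: y; apply: (@wordsP k A k^o) => [||v].
- exact: lin_comp lc (mr _).
- exact: lin_comp (cr _) lc.
case: u => [|a u]; first by rewrite mul1r qsh_counit1 mul1r.
case: v => [|b v]; first by rewrite mulr1 qsh_counit1 mulr1.
rewrite -!wconsE !c0 mul0r -[_ * _]/(qsh _ _) qshSS !(linPD lc) !c0.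
by rewrite !addr0.
Qed.

HB.instance Definition _ := isBialgebra.Build k QSh
  qsh_cop_linear (@wcounit_linear k A) (@deconc_coassoc k A)
  (@deconc_counitl k A) (@deconc_counitr k A) qsh_cop1 qsh_copM
  qsh_counit1 qsh_counitM.

End QuasiShuffle.

Section ReducedCoproduct.
Variables (k : fieldType) (H : bialgType k).

Definition aug_pred : pred H := fun h => counit h == 0.

Lemma aug_submod : submod_closed aug_pred.
Proof.
have lc : islin (counit : H -> k^o) := @counit_linear k H.
split=> [|c x y]; rewrite !unfold_in /aug_pred; first by rewrite (linP0 lc).
by move=> /eqP ex /eqP ey; rewrite counit_linear ex ey mulr0 addr0.
Qed.

HB.instance Definition _ := GRing.isSubmodClosed.Build k H aug_pred aug_submod.

(* The augmentation ideal H^+, the kernel of the counit. *)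
Record aug := Aug { aug_val :> H; _ : aug_val \in aug_pred }.

HB.instance Definition _ := [isSub for aug_val].
HB.instance Definition _ := [Choice of aug by <:].
HB.instance Definition _ := [SubChoice_isSubLmodule of aug by <:].

Lemma aug_projP (h : H) : h - counit h *: 1 \in aug_pred.
Proof.
have lc : islin (counit : H -> k^o) := @counit_linear k H.
rewrite unfold_in /aug_pred (linPD lc) (linPN lc) (linPZ _ lc) counit1.
by rewrite -[_ *: _]/(_ * _) mulr1 subrr.
Qed.

Definition aug_proj (h : H) : aug := Aug (aug_projP h).

Definition redcopH (h : H) : tensor H H := cop h - 1 \tens h - h \tens 1.

(* The reduced coproduct with its codomain cut down to the tensor square of
   H^+, as justified by [redcopE] and [tmap_augK]. *)
Definition redcop (h : aug) : tensor aug aug :=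
  tmap aug_proj aug_proj (redcopH h).

(* [redcopn n] is the n-th iterate, with values in the n-th tensor power of H^+;
   the iterates start at n = 1. *)
Fixpoint redcopn (n : nat) (h : aug) : words aug :=
  match n with
  | 0 => 0
  | 1 => word [:: h]
  | n'.+1 => tlift (fun a b => wcons a (redcopn n' b)) (redcop h)
  end.

Definition conilpotent : Prop :=
  forall h : aug, exists2 n : nat, (0 < n)%N & redcopn n h = 0.

(* For conilpotent H, all but finitely many terms of the sum vanish. *)
Definition iota (h : H) : words aug :=
  counit h *: word [::]
  + \sum_(n \in [set n : nat | (0 < n)%N]%classic) redcopn n (aug_proj h).

Lemma aug_val_linear : islin aug_val. Proof. by []. Qed.

Lemma counit_aug (h : aug) : counit (h : H) = 0.
Proof. by case: h => h /= /eqP. Qed.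

Lemma aug_projK (h : aug) : aug_proj h = h.
Proof. by apply: val_inj; rewrite /= counit_aug scale0r subr0. Qed.

Lemma aug_proj1 : aug_proj 1 = 0.
Proof. by apply: val_inj; rewrite /= counit1 scale1r subrr. Qed.

Lemma aug_proj_linear : islin aug_proj.
Proof.
move=> c x y; apply: val_inj => /=.
rewrite counit_linear scalerDl -scalerA scalerBr opprD addrACA.
by [].
Qed.

Lemma tmap_augK (t : tensor aug aug) :
  tmap aug_proj aug_proj (tmap aug_val aug_val t) = t.
Proof.
move: t; apply: tensorP => [||a b].
- exact: lin_comp (tmap_linear aug_proj_linear aug_proj_linear)
           (tmap_linear aug_val_linear aug_val_linear).
- exact: lin_id.
rewrite tmapE; try exact: aug_val_linear.
by rewrite tmapE ?aug_projK //; exact: aug_proj_linear.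
Qed.

Lemma redcopE (h : aug) : tmap aug_val aug_val (redcop h) = redcopH h.
Proof.
pose p (x : H) := x - counit x *: 1.
pose e (x : H) : H := counit x *: 1.
have le : islin e.
  by move=> c x y; rewrite /e counit_linear scalerDl scalerA.
have lc : islin (counit : H -> k^o) := @counit_linear k H.
have lp : islin p := lin_comp aug_val_linear aug_proj_linear.
have lt := tmap_linear aug_proj_linear aug_proj_linear.
have lpp := tmap_linear lp lp.
have -> : tmap aug_val aug_val (redcop h) = tmap p p (redcopH h).
  rewrite /redcop; move: (redcopH h); apply: tensorP => [||x y].
  - exact: lin_comp (tmap_linear aug_val_linear aug_val_linear) lt.
  - exact: lpp.
  - by rewrite !tmapE //; exact: aug_proj_linear.
have p1 : p 1 = 0 by rewrite /p counit1 scale1r subrr.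
rewrite {1}/redcopH !(linPD lpp) !(linPN lpp) !tmapE // p1.
rewrite (linP0 (@lin_tensr k H H _)) (linP0 (@lin_tensl k H H _)) !subr0.
have ppE (t : tensor H H) :
    tmap p p t = t - tmap e id t - tmap id e t + tmap e e t.
  move: t; apply: tensorP => [||x y].
  - exact: lpp.
  - apply: lin_add; last exact: (tmap_linear le le).
    apply: lin_add; last exact: (lin_opp (tmap_linear (@lin_id k H) le)).
    apply: lin_add; first exact: lin_id.
    exact: (lin_opp (tmap_linear le (@lin_id k H))).
  - rewrite !tmapE // /p -/(e x) -/(e y).
  rewrite (linPD (@lin_tensl k H H _)) (linPN (@lin_tensl k H H _)).
  rewrite !(linPD (@lin_tensr k H H _)) !(linPN (@lin_tensr k H H _)).
  by rewrite opprB addrA addrAC -!addrA; congr (_ + _); rewrite addrCA addrA.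
have leid := tmap_linear le (@lin_id k H).
have lide := tmap_linear (@lin_id k H) le.
have bl : bilin (fun x y : H => counit x *: y).
  split=> [y|x] c u v; last by rewrite scalerDr !scalerA mulrC.
  by rewrite counit_linear scalerDl scalerA.
have br : bilin (fun x y : H => counit y *: x).
  by split=> [y|x]; [apply: bl.2|apply: bl.1].
have E1 : tmap e id (cop (h : H)) = 1 \tens (h : H).
  rewrite -[in RHS](cop_counitl (h : H)).
  move: (cop (h : H)); apply: tensorP => [||x y].
  - exact: leid.
  - exact: lin_comp (@lin_tensr k H H 1) (tlift_linear bl).
  rewrite tmapE // tliftE // /e (linPZ _ (@lin_tensl k H H _)).
  by rewrite (linPZ _ (@lin_tensr k H H _)).
have E2 : tmap id e (cop (h : H)) = (h : H) \tens 1.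
  rewrite -[in RHS](cop_counitr (h : H)).
  move: (cop (h : H)); apply: tensorP => [||x y].
  - exact: lide.
  - exact: lin_comp (@lin_tensl k H H 1) (tlift_linear br).
  rewrite tmapE // tliftE // /e (linPZ _ (@lin_tensl k H H _)).
  by rewrite (linPZ _ (@lin_tensr k H H _)).
have E3 : tmap e e (cop (h : H)) = 0.
  have -> : tmap e e (cop (h : H)) = tmap id e (tmap e id (cop (h : H))).
    move: (cop (h : H)); apply: tensorP => [||x y].
    - exact: tmap_linear.
    - exact: lin_comp lide leid.
    by rewrite !tmapE.
  by rewrite E1 tmapE // /e counit_aug scale0r (linP0 (@lin_tensr k H H _)).
by rewrite ppE E1 E2 E3 addr0.
Qed.

Lemma redcop_linear : islin redcop.
Proof.
have lr : islin redcopH.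
  apply: lin_add; last exact: lin_opp (@lin_tensl k H H 1).
  apply: lin_add; first exact: cop_linear.
  exact: lin_opp (@lin_tensr k H H 1).
apply: lin_comp; first exact: tmap_linear aug_proj_linear aug_proj_linear.
exact: lin_comp lr aug_val_linear.
Qed.

Lemma redcopn_bilin n : islin (redcopn n) ->
  bilin (fun a b : aug => wcons a (redcopn n b)).
Proof.
move=> ln; split=> [b|a]; first exact: (wcons_bilin aug).1.
exact: lin_comp (lin_wcons a) ln.
Qed.

Lemma redcopn_linear n : islin (redcopn n).
Proof.
elim: n => [|[|n] IH]; first by move=> c x y; rewrite scaler0 addr0.
  by move=> c x y; rewrite /= (word_multilin [::]).
exact: lin_comp (tlift_linear (redcopn_bilin IH)) redcop_linear.
Qed.

Lemma iota1 : iota 1 = word [::].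
Proof.
rewrite /iota counit1 scale1r aug_proj1 fsbig1 ?addr0 // => n _.
exact: linP0 (redcopn_linear n).
Qed.

Lemma iota_aug (h : aug) :
  iota h = \sum_(n \in [set n : nat | (0 < n)%N]%classic) redcopn n h.
Proof. by rewrite /iota counit_aug scale0r add0r aug_projK. Qed.

End ReducedCoproduct.

Section Convolution.
Variables (k : fieldType) (H : bialgType k) (A : algType k).

(* U(H, A) *)
Definition unital_lin (f : H -> A) : Prop := linear f /\ f 1 = 1.

Definition conv (f g : H -> A) : H -> A :=
  fun h => tlift (fun x y => f x * g y) (cop h).

Definition conv1 : H -> A := fun h => counit h *: 1.

(* g is the inverse of f in U(H, A). *)
Definition is_conv_inv (f g : H -> A) : Prop :=
  [/\ unital_lin g, conv f g =1 conv1 & conv g f =1 conv1].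

(* QSh(phi) : QSh(H^+) -> QSh(A). Only the underlying space of QSh(H^+) is involved. *)
Definition QSh_map (phi : H -> A) : words (aug H) -> QSh A :=
  wlift (fun w => word [seq phi (aug_val h) | h <- w]).

Definition odot (f : QSh A -> A) (phi : H -> A) : H -> A :=
  fun h => f (QSh_map phi (iota h)).

End Convolution.

Section Jmap.
Variables (k : fieldType) (A : algType k).

Definition qsh_j_word (w : seq A) : A :=
  match w with [::] => 1 | [:: a] => a | _ => 0 end.

(* The map j *)
Definition qsh_j : QSh A -> A := wlift qsh_j_word.

Lemma qsh_j_multilin : multilin qsh_j_word.
Proof.
by case=> [|x [|y u]] [|z v] c a b //=; rewrite scaler0 addr0.
Qed.

Lemma qsh_jE w : qsh_j (word w) = qsh_j_word w.
Proof. by rewrite /qsh_j wliftE //; apply: qsh_j_multilin. Qed.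

Lemma qsh_j_unital : unital_lin qsh_j.
Proof.
by split; [exact: wlift_linear qsh_j_multilin | exact: qsh_jE [::]].
Qed.

End Jmap.

Lemma QSh_mapE (k : fieldType) (H : bialgType k) (A : algType k)
    (phi : H -> A) (w : seq (aug H)) : unital_lin phi ->
  QSh_map phi (word w) = word [seq phi (aug_val h) | h <- w].
Proof.
move=> [lphi _]; rewrite /QSh_map wliftE // => u v c a b.
by rewrite !map_cat /= lphi word_multilin.
Qed.

Arguments qsh_j {k A} t.

(* Main.v *)
(* Write Delta h = sum h1 \tens h2 and p for the projection of H onto H^+.
   Evaluating j * f = 1 on a word a w gives f(a w) = - a f(w) for every
   convolution inverse f of j, and iota satisfies
     iota(h) = counit(h) 1 + sum p(h1) iota(h2),
   the product being concatenation.  Hence g = f \odot phi satisfies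
   g(h) = counit(h) - sum phi(p(h1)) g(h2), which says that phi * g = 1.  This
   holds for every phi in U(H, A), so g in turn has a right inverse g', and
   phi = phi * g * g' = g', so that g is a two-sided inverse of phi. *)
Require Import Defs.
From mathcomp Require Import all_boot all_algebra.
From mathcomp Require Import monalg boolp classical_sets fsbigop.

Set Implicit Arguments.
Unset Strict Implicit.
Unset Printing Implicit Defensive.

Import GRing.Theory.
Local Open Scope ring_scope.

(* Otherwise [iota] is the enumeration of [seq]. *)
Local Notation iota := Defs.iota.

(** * Sums of linear maps and maps out of tensor products *)

Lemma lin_sum (k : fieldType) (U V : lmodType k) (I : Type) (r : seq I)
    (P : pred I) (f : I -> U -> V) :
  (forall i, islin (f i)) -> islin (fun x => \sum_(i <- r | P i) f i x).
Proof.
move=> lf c x y; rewrite scaler_sumr -big_split /=.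
by apply: eq_bigr => i _; apply: lf.
Qed.

(** Needed beside [tensorP], which only proves equality of two linear maps; the existence of a bound
    depending on the tensor is not of that form. *)
Lemma tensor_ind (k : fieldType) (V W : lmodType k) (P : tensor V W -> Prop) :
  P 0 -> (forall c s t, P s -> P t -> P (c *: s + t)) ->
  (forall v w, P (v \tens w)) -> forall t, P t.
Proof.
move=> P0 Pl Pt t; rewrite -[t]ppi_repr; set x := repr t.
have lp := @ppi_linear _ _ (@tens_rel k V W).
rewrite [x]monalgE (big_morph _ (linPD lp) (linP0 lp)).
apply: (big_ind P) => // [s u Ps Pu|[v w] _].
  by rewrite -[s]scale1r; apply: Pl.
have -> : << x@_(v, w) *g (v, w) >> = x@_(v, w) *: << (v, w) >> :> {malg k[_]}.
  by apply/malgP => j; rewrite mcoeffZ !mcoeffU mulrnAr mulr1.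
rewrite (linPZ _ lp) -[_ *: _]addr0; apply: Pl => //.
by have := Pt v w; rewrite /tens pgen.unlock.
Qed.

Section TensorLift.
Variables (k : fieldType) (V W U : lmodType k).

(** A tensor is a finite sum of pure tensors, so the maximum of their bounds serves for it. This
    carries the pointwise stabilisation of truncations over to a coproduct. *)
Lemma tlift_eventually (f : V -> W -> U) (F : nat -> V -> W -> U) :
  bilin f -> (forall M, bilin (F M)) ->
  (forall v w, exists N, forall M, (N <= M)%N -> f v w = F M v w) ->
  forall t, exists N, forall M, (N <= M)%N -> tlift f t = tlift (F M) t.
Proof.
move=> bf bF fF t; have lf := tlift_linear bf.
have lF M := tlift_linear (bF M).
elim/tensor_ind: t => [|c s t [Ns Es] [Nt Et]|v w].
- by exists 0%N => M _; rewrite (linP0 lf) (linP0 (lF M)).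
- exists (maxn Ns Nt) => M; rewrite geq_max => /andP[leN leT].
  by rewrite lf lF (Es M) ?(Et M).
- by have [N E] := fF v w; exists N => M /E; rewrite !tliftE.
Qed.

Lemma tlift_tmapl (V' : lmodType k) (g : V' -> V) (f : V -> W -> U) t :
  islin g -> bilin f ->
  tlift f (tmap g id t) = tlift (fun u w => f (g u) w) t.
Proof.
move=> lg bf; have lT := tlift_linear bf.
have bfg : bilin (fun u w => f (g u) w).
  by split=> [w|u]; [exact: lin_comp (bf.1 w) lg|exact: bf.2].
move: t; apply: tensorP => [||u w].
- exact: lin_comp lT (tmap_linear lg (@lin_id k W)).
- exact: tlift_linear.
by rewrite tmapE // !tliftE.
Qed.

Lemma tlift_tensD (f : V -> W -> U) v w t :
  bilin f -> tlift f (v \tens w + t) = f v w + tlift f t.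
Proof. by move=> bf; rewrite (linPD (tlift_linear bf)) tliftE. Qed.

End TensorLift.

(** * The convolution monoid of linear maps from H to A *)

Section Convolution.
Variables (k : fieldType) (H : bialgType k) (A : algType k).
Implicit Types f g h : H -> A.

Lemma conv_bilin f g : linear f -> linear g -> bilin (fun x y => f x * g y).
Proof.
move=> lf lg; split=> [y|x] c u v; first by rewrite lf mulrDl scalerAl.
by rewrite lg mulrDr scalerAr.
Qed.

Lemma conv_linear f g : linear f -> linear g -> linear (conv f g).
Proof.
move=> lf lg.
exact: lin_comp (tlift_linear (conv_bilin lf lg)) (@cop_linear k H).
Qed.

Lemma conv_unital1 f g : linear f -> linear g -> f 1 = 1 -> g 1 = 1 ->
  conv f g 1 = 1.
Proof.
move=> lf lg f1 g1; rewrite /conv cop1.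
by rewrite tliftE ?f1 ?g1 ?mulr1 //; apply: conv_bilin.
Qed.

Lemma conv1_linear : linear (@conv1 k H A).
Proof. by move=> c x y; rewrite /conv1 counit_linear scalerDl scalerA. Qed.

Lemma conv1_unital : @conv1 k H A 1 = 1.
Proof. by rewrite /conv1 counit1 scale1r. Qed.

Lemma conv1l f : linear f -> conv (@conv1 k H A) f =1 f.
Proof.
move=> lf x; rewrite -[in RHS](cop_counitl x) /conv.
have bl : bilin (fun x y : H => counit x *: y).
  split=> [y|u] c v w; last by rewrite scalerDr !scalerA mulrC.
  by rewrite counit_linear scalerDl scalerA.
have l1 := conv1_linear.
move: (cop x); apply: tensorP => [||u v].
- exact/tlift_linear/conv_bilin.
- exact: lin_comp lf (tlift_linear bl).
rewrite !tliftE //; last exact: conv_bilin.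
by rewrite /conv1 (linPZ _ lf) -scalerAl mul1r.
Qed.

Lemma conv1r f : linear f -> conv f (@conv1 k H A) =1 f.
Proof.
move=> lf x; rewrite -[in RHS](cop_counitr x) /conv.
have br : bilin (fun x y : H => counit y *: x).
  split=> [y|u] c v w; first by rewrite scalerDr !scalerA mulrC.
  by rewrite counit_linear scalerDl scalerA.
have l1 := conv1_linear.
move: (cop x); apply: tensorP => [||u v].
- exact/tlift_linear/conv_bilin.
- exact: lin_comp lf (tlift_linear br).
rewrite !tliftE //; last exact: conv_bilin.
by rewrite /conv1 (linPZ _ lf) -scalerAr mulr1.
Qed.

Lemma conv_mull (a : A) f g : linear f -> linear g ->
  conv (fun x => a * f x) g =1 (fun x => a * conv f g x).
Proof.
move=> lf lg x; have la := @lin_mulr k A a; rewrite /conv.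
move: (cop x); apply: tensorP => [||u v].
- exact/tlift_linear/(conv_bilin (lin_comp la lf)).
- exact: lin_comp la (tlift_linear (conv_bilin lf lg)).
rewrite !tliftE ?mulrA //; first exact: conv_bilin.
exact: conv_bilin (lin_comp la lf) lg.
Qed.

(** Both sides evaluate the trilinear map f u * g v * h w on an iterated coproduct, and
    coassociativity identifies the two up to [tassoc]. *)
Lemma convA f g h : linear f -> linear g -> linear h ->
  conv f (conv g h) =1 conv (conv f g) h.
Proof.
move=> lf lg lh x.
have bfg := conv_bilin lf lg; have bgh := conv_bilin lg lh.
have lfg := tlift_linear bfg; have lgh := tlift_linear bgh.
have bl : bilin (fun (t : tensor H H) y => tlift (fun u v => f u * g v) t * h y).
  split=> [y|t]; first exact: lin_comp (@lin_mull _ _ _) lfg.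
  exact: lin_comp (@lin_mulr _ _ _) lh.
have br : bilin (fun y (t : tensor H H) => f y * tlift (fun u v => g u * h v) t).
  split=> [t|y]; first exact: lin_comp (@lin_mull _ _ _) lf.
  exact: lin_comp (@lin_mulr _ _ _) lgh.
have lci := tmap_linear (@cop_linear k H) (@lin_id k H).
have lic := tmap_linear (@lin_id k H) (@cop_linear k H).
have El : conv (conv f g) h x = tlift (fun (t : tensor H H) y =>
    tlift (fun u v => f u * g v) t * h y) (tmap cop id (cop x)).
  rewrite /conv; move: (cop x); apply: tensorP => [||u v].
  - apply/tlift_linear/conv_bilin => //; exact: conv_linear.
  - exact: lin_comp (tlift_linear bl) lci.
  rewrite tmapE //; last exact: cop_linear.
  by rewrite !tliftE //; apply: conv_bilin => //; apply: conv_linear.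
have Er : conv f (conv g h) x = tlift (fun y (t : tensor H H) =>
    f y * tlift (fun u v => g u * h v) t) (tmap id cop (cop x)).
  rewrite /conv; move: (cop x); apply: tensorP => [||u v].
  - apply/tlift_linear/conv_bilin => //; exact: conv_linear.
  - exact: lin_comp (tlift_linear br) lic.
  rewrite tmapE //; last exact: cop_linear.
  by rewrite !tliftE //; apply: conv_bilin => //; apply: conv_linear.
rewrite El Er -cop_coassoc; move: (tmap cop id (cop x)).
apply: tensorP => [||t w].
- exact: lin_comp (tlift_linear br) (@tassoc_linear _ _ _ _).
- exact: tlift_linear.
move: t; apply: tensorP => [||u v].
- apply: lin_comp (tlift_linear br) _.
  exact: lin_comp (@tassoc_linear _ _ _ _) (@lin_tensl _ _ _ _).
- exact: lin_comp (tlift_linear bl) (@lin_tensl _ _ _ _).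
by rewrite tassocE !tliftE // mulrA.
Qed.

End Convolution.

(** * Iterated reduced coproducts and the recursion for [iota] *)

Section Iota.
Variables (k : fieldType) (H : bialgType k).
Local Notation aug := (aug H).

Lemma wcounit_redcopn n (h : aug) : wcounit (redcopn n h) = 0.
Proof.
have lw : islin (wcounit : words aug -> k^o) := @wcounit_linear k aug.
case: n => [|[|n]] /=; first exact: (linP0 lw).
  by rewrite -wconsE wcounitS.
move: (redcop h); apply: (@tensorP k aug aug k^o) => [||a b].
- exact: lin_comp lw (tlift_linear (redcopn_bilin (@redcopn_linear k H n.+1))).
- by move=> c s t; rewrite scaler0 addr0.
rewrite tliftE ?wcounitS //; exact: redcopn_bilin (@redcopn_linear k H n.+1).
Qed.

(* The map v_1..v_n |-> v_1..v_(n-1) Delta'(v_n) carries the n-th iterate of the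
   reduced coproduct to the next one without any appeal to coassociativity, so
   that an iterate vanishing at [h] forces all later ones to vanish. *)
Fixpoint split_last_word (w : seq aug) : words aug :=
  match w with
  | [::] => 0
  | a :: w' => if nilp w' then redcopn 2 a else wcons a (split_last_word w')
  end.

Lemma split_last_multilin : multilin split_last_word.
Proof.
elim=> [|x u IH] v c a b.
  rewrite !cat0s; case: v => [|y v]; first exact: redcopn_linear.
  exact: (wcons_bilin aug).1.
have E d : nilp (u ++ d :: v) = false by case: u {IH}.
by rewrite /= !E IH (lin_wcons x).
Qed.

Definition split_last : words aug -> words aug := wlift split_last_word.

Lemma split_last_linear : islin split_last.
Proof. exact: wlift_linear split_last_multilin. Qed.

(** The factor [wcounit x] extracts the part of [x] of length 0, where [a] is itself the last letter
    and gets split. *)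
Lemma split_last_wcons a x :
  split_last (wcons a x) = wcons a (split_last x) + wcounit x *: redcopn 2 a.
Proof.
have lS := split_last_linear.
move: x; apply: wordsP => [||w].
- exact: lin_comp lS (lin_wcons a).
- apply: lin_add; first exact: lin_comp (lin_wcons a) lS.
  by move=> c x y; rewrite wcounit_linear scalerDl scalerA.
have wS := wliftE _ split_last_multilin.
rewrite wconsE /split_last !wS; case: w => [|b w].
  by rewrite wcounit1 scale1r /= (linP0 (lin_wcons a)) add0r.
by rewrite -wconsE wcounitS scale0r addr0.
Qed.

(** [redcopn] grows by putting a letter in front, while [split_last] acts at the other end; the two
    commute because iterates have no component of length 0. *)
Lemma redcopnS n (h : aug) : redcopn n.+2 h = split_last (redcopn n.+1 h).
Proof.
elim: n h => [|n IH] h.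
  by rewrite /split_last wliftE //; apply: split_last_multilin.
have lr m := redcopn_bilin (@redcopn_linear k H m).
have lS := split_last_linear.
rewrite [LHS]/= [in RHS]/= -/(redcopn n.+2) -/(redcopn n.+1).
move: (redcop h); apply: tensorP => [||a b].
- exact: tlift_linear (lr n.+2).
- exact: lin_comp lS (tlift_linear (lr n.+1)).
rewrite (tliftE _ _ (lr n.+2)) (tliftE _ _ (lr n.+1)) split_last_wcons.
by rewrite wcounit_redcopn scale0r addr0 IH.
Qed.

(** The bound 0 < m excludes the default [redcopn 0], which is zero everywhere. *)
Lemma redcopn_eq0 m n (h : aug) :
  (0 < m <= n)%N -> redcopn m h = 0 -> redcopn n h = 0.
Proof.
case/andP=> m0 /subnK <- h0; elim: (n - m)%N => // d IH.
rewrite addSn; case: m m0 h0 IH => // m _ _; rewrite addnS => IH.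
by rewrite redcopnS IH (linP0 split_last_linear).
Qed.

(** Keeps the words of length less than M. Unlike the sum in [iota], its range does not depend on
    [h], so linearity is immediate. *)
Definition iota_trunc (M : nat) (h : H) : words aug :=
  counit h *: word [::] + \sum_(1 <= n < M) redcopn n (aug_proj h).

Lemma iota_trunc_linear M : islin (iota_trunc M).
Proof.
apply: lin_add; first by move=> c x y; rewrite counit_linear scalerDl scalerA.
by apply: lin_sum => n; apply: lin_comp (@redcopn_linear k H n) (@aug_proj_linear k H).
Qed.

Lemma iota_truncP : conilpotent H ->
  forall h : H, exists N, forall M, (N <= M)%N -> iota h = iota_trunc M h.
Proof.
move=> Hc h; have [N N0 hN] := Hc (aug_proj h); exists N => M le_NM.
rewrite /iota /iota_trunc; congr (_ + _).
rewrite (fsbigE (index_iota 1 M)) ?iota_uniq //=.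
- rewrite big_seq_cond [RHS]big_seq_cond; apply: eq_bigl => n.
  rewrite mem_index_iota mem_setE.
  by case: n => [|n] //=; rewrite !andbT.
- by move=> n /=; rewrite mem_index_iota => /andP[].
- move=> n n0; rewrite mem_index_iota n0 /= -leqNgt => le_Mn.
  by apply: redcopn_eq0 hN; rewrite N0 (leq_trans le_NM).
Qed.

Lemma iota_linear : conilpotent H -> islin (@iota k H).
Proof.
move=> Hc c x y.
have [N1 E1] := iota_truncP Hc x; have [N2 E2] := iota_truncP Hc y.
have [N3 E3] := iota_truncP Hc (c *: x + y).
(* One truncation computes [iota] at all three vectors. *)
pose M := maxn N1 (maxn N2 N3).
by rewrite (E1 M) ?(E2 M) ?(E3 M) ?iota_trunc_linear // !leq_max leqnn ?orbT.
Qed.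

Lemma aug_wcons_bilin (f : H -> words aug) : islin f ->
  bilin (fun a b : H => wcons (aug_proj a) (f b)).
Proof.
move=> lf; split=> [b|a].
  exact: lin_comp ((wcons_bilin aug).1 _) (@aug_proj_linear k H).
exact: lin_comp (lin_wcons _) lf.
Qed.

(** Removing the first letter lowers the length by one, hence [M.+1] against [M]. At M = 0 this
    would fail, since [iota_trunc 0] and [iota_trunc 1] coincide. *)
Lemma iota_truncS M (h : H) : (0 < M)%N -> iota_trunc M.+1 h = counit h *: word [::]
  + tlift (fun a b => wcons (aug_proj a) (iota_trunc M b)) (cop h).
Proof.
move=> M0; have lM := iota_trunc_linear M; have bM := aug_wcons_bilin lM.
have lT := tlift_linear bM.
have l0 x : wcons (0 : aug) x = 0 := linP0 ((wcons_bilin aug).1 x).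
rewrite /iota_trunc; congr (_ + _).
(* Replacing [h] by its projection changes the coproduct by a multiple of 1 \tens 1, which is killed
   since [aug_proj 1] is 0. *)
transitivity (tlift (fun a b => wcons (aug_proj a) (iota_trunc M b))
                (cop (aug_proj h : H))); last first.
  rewrite /= (linPD (@cop_linear k H)) (linPN (@cop_linear k H)).
  rewrite (linPZ _ (@cop_linear k H)) cop1 (linPD lT) (linPN lT) (linPZ _ lT).
  by rewrite tliftE // aug_proj1 l0 scaler0 subr0.
move: (aug_proj h) => {}h.
(* Of the three terms, h \tens 1 gives the word of length 1, 1 \tens h gives 0, and the reduced
   coproduct gives the longer words. *)
have -> : cop (h : H) = redcopH h + (h : H) \tens 1 + 1 \tens (h : H).
  by rewrite /redcopH [X in _ = X + _]subrK subrK.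
rewrite (linPD lT) (linPD lT) !tliftE // aug_proj1 l0 addr0 aug_projK.
have -> : iota_trunc M 1 = word [::].
  rewrite /iota_trunc counit1 scale1r aug_proj1 big1 ?addr0 // => n _.
  exact: linP0 (@redcopn_linear k H n).
rewrite wconsE big_ltn // addrC; congr (_ + _).
rewrite -redcopE big_add1 /= big_nat.
have lr m := redcopn_bilin (@redcopn_linear k H m).
(* The recursive clause of [redcopn n.+1] applies only for n > 0, which the range of summation
   ensures. *)
rewrite (eq_bigr (fun n => tlift (fun a b => wcons a (redcopn n b)) (redcop h))); last first.
  by case.
rewrite -big_nat; move: (redcop h).
have lv := @aug_val_linear k H.
apply: tensorP => [||a b].
- by apply: lin_sum => n; apply: tlift_linear (lr n).
- exact: lin_comp lT (tmap_linear lv lv).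
rewrite tmapE // tliftE // aug_projK /iota_trunc counit_aug scale0r add0r aug_projK.
have lc := lin_wcons a.
rewrite (big_morph _ (linPD lc) (linP0 lc)); apply: eq_bigr => n _.
by rewrite tliftE.
Qed.

Lemma iotaS (h : H) : conilpotent H -> iota h = counit h *: word [::]
  + tlift (fun a b => wcons (aug_proj a) (iota b)) (cop h).
Proof.
move=> Hc; have li := iota_linear Hc; have bi := aug_wcons_bilin li.
have bM M := aug_wcons_bilin (iota_trunc_linear M).
have [N1 E1] := iota_truncP Hc h.
have [N2 E2] := tlift_eventually bi bM (fun a b =>
  let: ex_intro N E := iota_truncP Hc b in
  ex_intro _ N (fun M le => congr1 (wcons (aug_proj a)) (E M le))) (cop h).
(* The successor makes [M] positive, as [iota_truncS] requires. *)
pose M := (maxn N1 N2).+1.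
rewrite (E1 M.+1) ?(E2 M) ?iota_truncS // /M.
- by rewrite ltnW // ltnS leq_maxr.
- exact: leq_trans (leq_maxl _ _) (leqW (leqnSn _)).
Qed.

End Iota.

(** * The convolution inverse of j on the quasi-shuffle bialgebra *)

Section Jinv.
Variables (k : fieldType) (A : algType k).
Implicit Types (f : QSh A -> A) (x : QSh A).

Lemma conv1_wcons a x : @conv1 k (QSh A) A (wcons a x) = 0.
Proof. by rewrite /conv1 -[counit _]/(wcounit _) wcounitS scale0r. Qed.

Lemma QSh_eq (f g : QSh A -> A) : linear f -> linear g -> f 1 = g 1 ->
  (forall a w, f (word w) = g (word w) ->
    f (wcons a (word w)) = g (wcons a (word w))) -> f =1 g.
Proof. exact: words_eq. Qed.

Lemma cop_wcons a x : cop (wcons a x : QSh A) =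
  (1 : QSh A) \tens (wcons a x : QSh A)
  + tmap (wcons a : QSh A -> QSh A) id (cop x).
Proof. exact: deconcS. Qed.

(** Deconcatenation cuts a word either before its first letter, where f contributes f 1 = 1, or
    after it. *)
Lemma conv_wcons (f g : QSh A -> A) a x : linear f -> linear g -> f 1 = 1 ->
  conv f g (wcons a x) = g (wcons a x) + conv (fun u : QSh A => f (wcons a u)) g x.
Proof.
move=> lf lg f1; have bfg := conv_bilin lf lg.
have lw : islin (wcons a : QSh A -> QSh A) := lin_wcons a.
rewrite /conv cop_wcons; apply: etrans (tlift_tensD _ _ _ bfg) _.
by rewrite f1 mul1r; congr (_ + _); apply: tlift_tmapl.
Qed.

(** Since j vanishes on words of length at least 2, j (a u) equals a times the counit of u, and the
    counit is neutral for convolution. *)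
Lemma conv_qsh_jS f a x : linear f ->
  conv (qsh_j : QSh A -> A) f (wcons a x) = f (wcons a x) + a * f x.
Proof.
move=> lf; have [lj j1] := qsh_j_unital A.
rewrite conv_wcons //; congr (_ + _).
rewrite -[in RHS](conv1l lf x) -(conv_mull _ (@conv1_linear _ _ _) lf).
congr (conv _ f x); apply/funext; apply: wordsP => [||w].
- exact: lin_comp lj (lin_wcons a).
- exact: lin_comp (@lin_mulr k A a) (@conv1_linear k (QSh A) A).
rewrite wconsE qsh_jE; case: w => [|b w].
  by rewrite [conv1 _ _]conv1_unital mulr1.
by rewrite -wconsE conv1_wcons mulr0.
Qed.

(** The signed product (-1)^n a_1 ... a_n, the only solution of the recursion that [conv_qsh_jS]
    imposes on an inverse. *)
Fixpoint qsh_jinv_word (w : seq A) : A :=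
  if w is a :: w' then - (a * qsh_jinv_word w') else 1.

Lemma qsh_jinv_multilin : multilin qsh_jinv_word.
Proof.
elim=> [|x u IH] v c a b /=.
  by rewrite mulrDl opprD scalerN scalerAl.
by rewrite IH mulrDr opprD scalerN scalerAr.
Qed.

Definition qsh_jinv : QSh A -> A := wlift qsh_jinv_word.

Lemma qsh_jinv_unital : unital_lin qsh_jinv.
Proof.
split; first exact: wlift_linear qsh_jinv_multilin.
by rewrite -[1]/(word [::]) /qsh_jinv wliftE //; apply: qsh_jinv_multilin.
Qed.

Lemma qsh_jinvS a x : qsh_jinv (wcons a x) = - (a * qsh_jinv x).
Proof.
have [lj _] := qsh_jinv_unital.
move: x; apply: wordsP => [||w].
- exact: lin_comp lj (lin_wcons a).
- exact: lin_opp (lin_comp (@lin_mulr _ _ a) lj).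
by rewrite wconsE /qsh_jinv !wliftE //; apply: qsh_jinv_multilin.
Qed.

Lemma qsh_jinvP : is_conv_inv (qsh_j : QSh A -> A) qsh_jinv.
Proof.
have [lj j1] := qsh_j_unital A; have [li i1] := qsh_jinv_unital.
split; first by split.
- apply: (QSh_eq (conv_linear lj li) (@conv1_linear _ _ _)) => [|a w _].
    by rewrite conv_unital1 // conv1_unital.
  by rewrite conv_qsh_jS // conv1_wcons qsh_jinvS addNr.
(* On a nonempty word a w, induction turns the convolution into j (a w) - a * counit w: this is a -
   a when w is empty, and both terms are 0 otherwise. *)
- apply: (QSh_eq (conv_linear li lj) (@conv1_linear _ _ _)) => [|a w].
    by rewrite conv_unital1 // conv1_unital.
  rewrite conv1_wcons conv_wcons // (funext (qsh_jinvS a)).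
  rewrite (funext (fun x => esym (mulNr a (qsh_jinv x)))) conv_mull // => ->.
  rewrite mulNr; case: w => [|b w].
    by rewrite [conv1 _ _]conv1_unital mulr1 wconsE qsh_jE subrr.
  by rewrite -wconsE conv1_wcons mulr0 subr0 !wconsE qsh_jE.
Qed.

Lemma is_conv_inv_jS f a x : is_conv_inv (qsh_j : QSh A -> A) f ->
  f (wcons a x) = - (a * f x).
Proof.
move=> [[lf _] jf _]; apply/eqP; rewrite -addr_eq0 -conv_qsh_jS //.
by rewrite jf conv1_wcons.
Qed.

End Jinv.

(** * The right inverse of an arbitrary unital linear map *)

Section RightInverse.
Variables (k : fieldType) (A : algType k) (H : bialgType k).
Hypothesis Hconil : conilpotent H.
Variable f : QSh A -> A.
Hypothesis fU : unital_lin f.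
Hypothesis fS : forall a x, f (wcons a x) = - (a * f x).
Variable phi : H -> A.
Hypothesis phiU : unital_lin phi.

Lemma QSh_map_linear : islin (QSh_map phi).
Proof.
have [lphi _] := phiU; apply: wlift_linear => u v c a b.
by rewrite !map_cat /= lphi word_multilin.
Qed.

Lemma QSh_map_wcons a x : QSh_map phi (wcons a x) = wcons (phi a) (QSh_map phi x).
Proof.
move: x; apply: wordsP => [||w].
- exact: lin_comp QSh_map_linear (lin_wcons a).
- exact: lin_comp (lin_wcons _) QSh_map_linear.
by rewrite wconsE !QSh_mapE // wconsE.
Qed.

Lemma odot_unital : unital_lin (odot f phi).
Proof.
have [lf f1] := fU; split; last first.
  by rewrite /odot iota1 QSh_mapE.
exact: lin_comp lf (lin_comp QSh_map_linear (iota_linear Hconil)).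
Qed.

Lemma conv_odotr : conv phi (odot f phi) =1 @conv1 k H A.
Proof.
have [lf f1] := fU; have [lphi phi1] := phiU; have [lo _] := odot_unital.
have lF := lin_comp lf QSh_map_linear.
have li := aug_wcons_bilin (iota_linear Hconil).
have lT := tlift_linear (conv_bilin lphi lo).
have l1 := @conv1_linear k H A.
have lT1 := tlift_linear (conv_bilin l1 lo).
(* The recursion for f turns a first letter p(a) into the factor - phi (p(a)), which is counit a -
   phi a because phi 1 = 1. *)
have E t : f (QSh_map phi (tlift (fun a b => wcons (aug_proj a) (iota b)) t))
    = tlift (fun x y => conv1 A x * odot f phi y) t
      - tlift (fun x y => phi x * odot f phi y) t.
  move: t; apply: tensorP => [||a b].
  - exact: lin_comp lF (tlift_linear li).
  - exact: lin_add lT1 (lin_opp lT).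
  rewrite !tliftE //; try exact: conv_bilin.
  rewrite QSh_map_wcons fS /= (linPD lphi) (linPN lphi) (linPZ _ lphi) phi1.
  by rewrite -mulrBl -mulNr opprB.
(* Adding g - phi * g to both sides, where g is [odot f phi], leaves g = 1 + (g - phi * g), which is
   [iotaS] pushed through f and [QSh_map phi]. *)
move=> h; apply: (addIr (odot f phi h - conv phi (odot f phi) h)).
rewrite addrC subrK {1}/odot iotaS //; apply: etrans (linPD lF _ _) _.
congr (_ + _); last by apply: etrans (E _) _; congr (_ - _); exact: conv1l.
by apply: etrans (linPZ _ lF _) _; rewrite QSh_mapE // [f _]f1.
Qed.

End RightInverse.

Theorem corollary1 (k : fieldType) (char0 : [pchar k] =i pred0)
    (A : algType k) (H : bialgType k) (Hconil : conilpotent H)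
    (phi : H -> A) (phiU : unital_lin phi) :
  (exists jinv : QSh A -> A, is_conv_inv (qsh_j : QSh A -> A) jinv) /\
  (forall jinv : QSh A -> A,
     is_conv_inv (qsh_j : QSh A -> A) jinv ->
     is_conv_inv phi (odot jinv phi)).
Proof.
split; first by exists (@qsh_jinv k A); apply: qsh_jinvP.
move=> f fj; have [fU _ _] := fj; have fS a x := is_conv_inv_jS a x fj.
set g := odot f phi; have gU : unital_lin g := odot_unital Hconil fU phiU.
have phig : conv phi g =1 _ := conv_odotr Hconil fU fS phiU.
have gg' : conv g (odot f g) =1 _ := conv_odotr Hconil fU fS gU.
have [lphi _] := phiU; have [lg _] := gU.
have [lg' _] := odot_unital Hconil fU gU.
(* The remaining identity g * phi = 1 becomes [gg'] once phi is identified with [odot f g]. *)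
split=> //; suff -> : phi = odot f g by [].
apply/funext => h; rewrite -(conv1r lphi) -(conv1l lg').
by rewrite -{1}(funext gg') -(funext phig) convA.
Qed.
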